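(* Let $d,N$ be positive integers, $\kappa(x,y)=1/(x-y)^d$, and let $X,Y\subset\mathbb{C}$ be finite nonempty sets with $m=|X|$, $n=|Y|$. Suppose $0<|x|<\gamma_1<\gamma_2<|y|<\gamma_3$ for any $x\in X$, $y\in Y$, and that the $N$ proxy points in $Z$ are located on the proxy surface (circle centered at $0$) with radius $\gamma^*\in(\gamma_1,\gamma_2)$, where $\gamma^*$ is the nearly optimal radius defined in the context. Let $\hat X\subset X$ with $r=|\hat X|$ and $\hat Y\subset Y$ be the sets of representative points, and $U$, $V$ the matrices, in the factorizations $$K^{(X,Z)}\approx UK^{(\hat X,Z)},\quad U=P\begin{pmatrix} I \\ E \end{pmatrix},\qquad\qquad K^{(\hat X,Y)}\approx K^{(\hat X,\hat Y)}V^T,\quad V=Q\begin{pmatrix} I \\ F \end{pmatrix},$$ with $P,Q$ permutation matrices. Let the relative tolerance in the kernel approximation be $\tau_1$, i.e. $|\varepsilon(x,y)|<\tau_1$ for all $x\in X$, $y\in Y$ (and for proxy radius $\gamma^*$), where $\varepsilon(x,y)=\frac{\tilde\kappa(x,y)-\kappa(x,y)}{\kappa(x,y)}$, and let the relative approximation tolerance (in Frobenius norm) in the two factorizations be $\tau_2$, i.e. $$\lVert K^{(X,Z)}-UK^{(\hat X,Z)}\rVert_F\le\tau_2\lVert K^{(X,Z)}\rVert_F,\qquad \lVert K^{(\hat X,Y)}-K^{(\hat X,\hat Y)}V^T\rVert_F\le\tau_2\lVert K^{(\hat X,Y)}\rVert_F.$$ Assume the entries of $E$ and $F$ have magnitudes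 bounded by $e$. Then the approximation $K^{(X,Y)}\approx UK^{(\hat X,Y)}$ satisfies $$\frac{\lVert K^{(X,Y)}-UK^{(\hat{X},Y)}\rVert_F}{\lVert K^{(X,Y)}\rVert_F}<s_1\tau_1+s_2\tau_2,$$ where $$s_1=1+\sqrt{r+(m-r)re^2}\,\sqrt{1-\frac{(m-r)(\gamma_2-\gamma_1)^{2d}}{m(\gamma_1+\gamma_3)^{2d}}},\qquad s_2=\frac{\gamma^*(\gamma_1+\gamma_3)^d}{(\gamma_2-\gamma^* )(\gamma^*-\gamma_1)^d}.$$ The approximation $K^{(X,Y)}\approx UK^{(\hat X,\hat Y)}V^T$ satisfies $$\frac{\lVert K^{(X,Y)}-UK^{(\hat{X},\hat{Y})}V^T\rVert_F}{\lVert K^{(X,Y)}\rVert_F}<s_1\tau_1+\tilde{s}_2\tau_2,$$ where $\tilde{s}_2=s_2+s_1-1$.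
   Context: For finite sets $A,B\subset\mathbb{C}$, $K^{(A,B)}=(\kappa(a,b))_{a\in A,b\in B}$; $\|\cdot\|_F$ is the Frobenius norm; $I$ denotes an identity matrix of the appropriate size, so that $U$ is $m\times r$ with $E$ of size $(m-r)\times r$, and $V$ is $n\times|\hat Y|$ with $F$ of size $(n-|\hat Y|)\times|\hat Y|$. For a proxy radius $\gamma>0$ the proxy points are $Z=\{z_j\}_{j=1}^N$, $z_j=\gamma\exp\!\left(\frac{2j\pi\mathbf{i}}{N}\right)$ (with $\mathbf{i}=\sqrt{-1}$), and the proxy approximation of the kernel is $$\tilde\kappa(x,y)=\sum_{j=1}^{N}\kappa(x,z_j)\,\phi(z_j,y),\qquad \phi(z,y)=\frac{1}{N}\,\frac{z}{y-z}\quad(y\neq z).$$ The two factorizations are strong rank-revealing QR (interpolative) decompositions: $K^{(\hat X,Z)}$ consists of selected rows of $K^{(X,Z)}$ and $K^{(\hat X,\hat Y)}$ of selected columns of $K^{(\hat X,Y)}$; only the stated tolerance and entry bounds on them are used. The radius $\gamma^*$ is the unique minimizer over $\gamma\in(\gamma_1,\gamma_2)$ of $g\!\left((\gamma_2/\gamma)^N\right)+\hat c\,g\!\left((\gamma/\gamma_1)^N\right)$, where $g(t)=\frac1{t-1}$, $\hat c=1$ if $d=1$ (in which case $\gamma^*=\sqrt{\gamma_1\gamma_2}$), and $\hat{c}=2+2\sum_{j=1}^{d-1}\frac{[(\gamma_3/\gamma_1+1)N]^j(2d)^{j-1}}{j!}$ if $d\ge2$. *)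

(* Defs.v *)
From HB Require Import structures.
From mathcomp Require Import all_boot all_order all_algebra all_fingroup finmap.
From mathcomp Require Import complex.
From mathcomp Require Import all_classical all_reals all_analysis.

Set Implicit Arguments.
Unset Strict Implicit.
Unset Printing Implicit Defensive.

Import Order.TTheory GRing.Theory Num.Theory.
Import Normc.

Local Open Scope ring_scope.

(* Moduli are taken with [normc], which has values in R, whereas the generic
   norm of R[i] has values in R[i]. *)

Definition frob_norm (R : realType) (m n : nat) (A : 'M[R[i]]_(m, n)) : R :=
  Num.sqrt (\sum_i \sum_j normc (A i j) ^+ 2).

Definition kappa (R : realType) (d : nat) (x y : R[i]) : R[i] :=
  1 / (x - y) ^+ d.

(* Rows and columns follow the given listings of A and B. A finite set coerces
   to a duplicate-free listing of its elements. *)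
Definition kernel_mx (R : realType) (d : nat) (A B : seq R[i]) :
    'M[R[i]]_(size A, size B) :=
  \matrix_(i, j) kappa d A`_i B`_j.

Definition expi (R : realType) (t : R) : R[i] := Complex (cos t) (sin t).

Definition proxy_point (R : realType) (N : nat) (gamma : R) (j : nat) : R[i] :=
  real_complex R gamma * expi (2 * j%:R * pi / N%:R).

Definition proxy_points (R : realType) (N : nat) (gamma : R) : seq R[i] :=
  [seq proxy_point N gamma j | j <- iota 1 N].

Definition phi (R : realType) (N : nat) (z y : R[i]) : R[i] :=
  1 / N%:R * (z / (y - z)).

Definition kappa_tilde (R : realType) (d N : nat) (gamma : R) (x y : R[i]) :
    R[i] :=
  \sum_(1 <= j < N.+1)
    kappa d x (proxy_point N gamma j) * phi N (proxy_point N gamma j) y.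

Definition proxy_error (R : realType) (d N : nat) (gamma : R) (x y : R[i]) :
    R[i] :=
  (kappa_tilde d N gamma x y - kappa d x y) / kappa d x y.

Definition radius_g (R : realType) (t : R) : R := 1 / (t - 1).

Definition c_hat (R : realType) (d N : nat) (gamma1 gamma3 : R) : R :=
  if d == 1%N then 1
  else 2 + 2 * \sum_(1 <= j < d)
    ((gamma3 / gamma1 + 1) * N%:R) ^+ j * (2 * d%:R) ^+ j.-1 / j`!%:R.

Definition radius_objective (R : realType) (d N : nat)
    (gamma1 gamma2 gamma3 gamma : R) : R :=
  radius_g ((gamma2 / gamma) ^+ N)
  + c_hat d N gamma1 gamma3 * radius_g ((gamma / gamma1) ^+ N).

(* The minimizer is unique, because the objective is strictly convex in ln gamma
   on the open interval. *)
Definition nearly_optimal_radius (R : realType) (d N : nat)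
    (gamma1 gamma2 gamma3 gamma : R) : Prop :=
  gamma1 < gamma < gamma2 /\
  forall gamma', gamma1 < gamma' < gamma2 ->
    radius_objective d N gamma1 gamma2 gamma3 gamma
    <= radius_objective d N gamma1 gamma2 gamma3 gamma'.

(* P times the block column (I; E); the cast only identifies r + (m - r) with m.
   As P and E are arbitrary, the form of this matrix does not depend on the
   order in which the selected points are listed. *)
Definition interp_mx (R : realType) (m r : nat) (hr : (r <= m)%N) (P : 'S_m)
    (E : 'M[R[i]]_(m - r, r)) : 'M[R[i]]_(m, r) :=
  perm_mx P *m castmx (subnKC hr, erefl r) (col_mx 1%:M E).

Definition s1 (R : realType) (d m r : nat) (gamma1 gamma2 gamma3 e : R) : R :=
  1 + Num.sqrt (r%:R + (m - r)%N%:R * r%:R * e ^+ 2)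
      * Num.sqrt (1 - (m - r)%N%:R * (gamma2 - gamma1) ^+ (2 * d)%N
                      / (m%:R * (gamma1 + gamma3) ^+ (2 * d)%N)).

Definition s2 (R : realType) (d : nat) (gamma1 gamma2 gamma3 gamma : R) : R :=
  gamma * (gamma1 + gamma3) ^+ d / ((gamma2 - gamma) * (gamma - gamma1) ^+ d).

Definition s2_tilde (R : realType) (d m r : nat)
    (gamma1 gamma2 gamma3 gamma e : R) : R :=
  s2 d gamma1 gamma2 gamma3 gamma + s1 d m r gamma1 gamma2 gamma3 e - 1.

(* Main.v *)
(* Since the proxy kernel is K^(X,Z) Phi with Phi = (phi(z, y)), the row error
   splits as
     K^(X,Y) - U K^(Xhat,Y) = (K^(X,Y) - K^(X,Z) Phi)
        + (K^(X,Z) - U K^(Xhat,Z)) Phi + U (K^(Xhat,Z) Phi - K^(Xhat,Y)).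
   The outer terms are controlled entrywise by tau1, the last one also using
   |U|_F^2 <= r + (m - r) r e^2 and the fraction of |K^(X,Y)|_F^2 carried by the
   rows outside Xhat; the middle term is at most tau2 |K^(X,Z)|_F |Phi|_F, and
   the triangle inequality for |x - z|, |y - z| and |x - y| turns it into
   s2 tau2 |K^(X,Y)|_F. The column factorization adds
   U (K^(Xhat,Y) - K^(Xhat,Yhat) V^T). *)
Require Import Defs.
From HB Require Import structures.
From mathcomp Require Import all_boot all_order all_algebra all_fingroup finmap.
From mathcomp Require Import complex.
From mathcomp Require Import ring lra.
From mathcomp Require Import all_classical all_reals all_analysis.
Import Order.TTheory GRing.Theory Num.Theory.
Import Normc.
Local Open Scope fset_scope.
Local Open Scope ring_scope.

(** * Cauchy-Schwarz and moduli of complex numbers *)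

(** Lagrange's identity: the sum of [(a i * b j - a j * b i) ^+ 2] over all pairs is twice the gap
    between the two sides. The squared form avoids square roots, so an ordered domain suffices. *)
Lemma sum_cauchy_schwarz {R : realDomainType} {I : finType} (a b : I -> R) :
  (\sum_i a i * b i) ^+ 2 <= (\sum_i a i ^+ 2) * (\sum_i b i ^+ 2).
Proof.
have Lagrange : 0 <= \sum_i \sum_j (a i * b j - a j * b i) ^+ 2.
  by apply: sumr_ge0 => i _; apply: sumr_ge0 => j _; rewrite sqr_ge0.
have expand : \sum_i \sum_j (a i * b j - a j * b i) ^+ 2 =
    2 * ((\sum_i a i ^+ 2) * (\sum_i b i ^+ 2) - (\sum_i a i * b i) ^+ 2).
  have square i j : (a i * b j - a j * b i) ^+ 2 =
      a i ^+ 2 * b j ^+ 2 + b i ^+ 2 * a j ^+ 2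
      - 2 * ((a i * b i) * (a j * b j)) by ring.
  under eq_bigr => i _ do under eq_bigr => j _ do rewrite square.
  under eq_bigr => i _ do rewrite sumrB big_split /= -mulr_sumr.
  rewrite sumrB big_split /= -mulr_suml -big_distrlr /=.
  under [X in _ - X]eq_bigr => i _ do rewrite -mulr_sumr.
  rewrite -mulr_sumr -!big_distrlr /= expr2.
  ring.
by move: Lagrange; rewrite expand pmulr_rge0 ?ltr0n // subr_ge0.
Qed.

Lemma normcB_ge {R : rcfType} (x y : R[i]) : normc x - normc y <= normc (x - y).
Proof. by rewrite lerBlDr; have := le_normcD (x - y) y; rewrite subrK. Qed.

Lemma normcB_le {R : rcfType} (x y : R[i]) : normc (x - y) <= normc x + normc y.
Proof. by rewrite (le_trans (le_normcD _ _)) ?normcN. Qed.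

Lemma normc_ge0 {R : rcfType} (x : R[i]) : 0 <= normc x.
Proof. by case: x => a b; apply: sqrtr_ge0. Qed.

Lemma normcX {R : rcfType} (x : R[i]) n : normc (x ^+ n) = normc x ^+ n.
Proof.
by elim: n => [|n IHn]; rewrite ?expr0 ?normc1 // !exprS normcM IHn.
Qed.

Lemma normc_real {R : rcfType} (a : R) : normc (real_complex R a) = `|a|.
Proof. by rewrite /= expr0n addr0 sqrtr_sqr. Qed.

Lemma normc_sum_le {R : rcfType} {I : finType} (F : I -> R[i]) :
  normc (\sum_i F i) <= \sum_i normc (F i).
Proof.
elim/big_ind2: _ => // [|x1 x2 y1 y2 h1 h2]; first by rewrite normc0.
exact: le_trans (le_normcD _ _) (lerD h1 h2).
Qed.

(** * The Frobenius norm: triangle inequality, products, entrywise comparison *)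

Lemma frob_norm_ge0 {R : realType} {m n} (A : 'M[R[i]]_(m, n)) : 0 <= frob_norm A.
Proof. exact: sqrtr_ge0. Qed.

Lemma sqr_frob_norm {R : realType} {m n} (A : 'M[R[i]]_(m, n)) :
  frob_norm A ^+ 2 = \sum_i \sum_j normc (A i j) ^+ 2.
Proof.
rewrite sqr_sqrtr //.
by apply: sumr_ge0 => i _; apply: sumr_ge0 => j _; rewrite sqr_ge0.
Qed.

Lemma frob_norm_le_sqr {R : realType} {m n} (A : 'M[R[i]]_(m, n)) c :
  0 <= c -> (frob_norm A <= c) = (frob_norm A ^+ 2 <= c ^+ 2).
Proof. by move=> c0; rewrite ler_pXn2r // nnegrE frob_norm_ge0. Qed.

(** Minkowski's inequality: the moduli of the entries form vectors indexed by pairs [(i, j)], and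
    Cauchy-Schwarz bounds the cross term of the squared sum. *)
Lemma frob_normD {R : realType} {m n} (A B : 'M[R[i]]_(m, n)) :
  frob_norm (A + B) <= frob_norm A + frob_norm B.
Proof.
rewrite frob_norm_le_sqr ?addr_ge0 ?frob_norm_ge0 // sqrrD.
pose a (p : 'I_m * 'I_n) := normc (A p.1 p.2).
pose b (p : 'I_m * 'I_n) := normc (B p.1 p.2).
have sA : frob_norm A ^+ 2 = \sum_p a p ^+ 2 by rewrite sqr_frob_norm pair_big.
have sB : frob_norm B ^+ 2 = \sum_p b p ^+ 2 by rewrite sqr_frob_norm pair_big.
have ab : \sum_p a p * b p <= frob_norm A * frob_norm B.
  (* The product of norms is written as the square root of its square, which brings the claim to the
     squared form of Cauchy-Schwarz. *)
  rewrite -[leRHS]ger0_norm ?mulr_ge0 ?frob_norm_ge0 //.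
  rewrite -sqrtr_sqr exprMn sA sB; apply: le_trans (ler_norm _) _.
  rewrite -sqrtr_sqr ler_sqrt ?sum_cauchy_schwarz //.
  by rewrite -sA -sB mulr_ge0 ?sqr_ge0.
apply: (@le_trans _ _ (\sum_p (a p + b p) ^+ 2)).
  rewrite sqr_frob_norm pair_big /=; apply: ler_sum => p _.
  by rewrite mxE ler_pXn2r ?nnegrE ?addr_ge0 ?normc_ge0 ?le_normcD.
under eq_bigr do rewrite sqrrD.
by rewrite !big_split /= -!sA -!sB lerD2r lerD2l mulr2n lerD.
Qed.

(** Cauchy-Schwarz applies to each entry, a row of [A] against a column of [B]. Once the sum for [B]
    is taken column by column, the resulting double sum factors into the two squared norms. *)
Lemma frob_normM {R : realType} {m n p} (A : 'M[R[i]]_(m, n)) (B : 'M[R[i]]_(n, p)) :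
  frob_norm (A *m B) <= frob_norm A * frob_norm B.
Proof.
rewrite frob_norm_le_sqr ?mulr_ge0 ?frob_norm_ge0 // exprMn !sqr_frob_norm.
rewrite [X in _ * X]exchange_big /= big_distrlr /=.
apply: ler_sum => i _; apply: ler_sum => j _; rewrite mxE.
apply: le_trans (sum_cauchy_schwarz _ _).
rewrite ler_pXn2r ?nnegrE ?normc_ge0 ?sumr_ge0 // => [|k _].
  apply: le_trans (normc_sum_le _) _.
  by under eq_bigr do rewrite normcM.
by rewrite mulr_ge0 ?normc_ge0.
Qed.

Lemma frob_norm_le {R : realType} {m n p q} (A : 'M[R[i]]_(m, n)) (B : 'M[R[i]]_(p, q)) c :
  0 <= c ->
  \sum_i \sum_j normc (A i j) ^+ 2
    <= c ^+ 2 * \sum_i \sum_j normc (B i j) ^+ 2 ->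
  frob_norm A <= c * frob_norm B.
Proof.
move=> c0 AB.
by rewrite frob_norm_le_sqr ?mulr_ge0 ?frob_norm_ge0 // exprMn !sqr_frob_norm.
Qed.

Lemma frob_norm_le_entry {R : realType} {m n} (A B : 'M[R[i]]_(m, n)) c : 0 <= c ->
  (forall i j, normc (A i j) <= c * normc (B i j)) ->
  frob_norm A <= c * frob_norm B.
Proof.
move=> c0 AB; apply: frob_norm_le => //.
rewrite mulr_sumr; apply: ler_sum => i _.
rewrite mulr_sumr; apply: ler_sum => j _.
by rewrite -exprMn ler_pXn2r ?nnegrE ?mulr_ge0 ?normc_ge0.
Qed.

(** Strictness survives summation because both dimensions are positive; the strict inequality of the
    theorem comes from here. *)
Lemma frob_norm_lt_entry {R : realType} {m n} (A B : 'M[R[i]]_(m, n)) c :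
  (0 < m)%N -> (0 < n)%N ->
  (forall i j, normc (A i j) < c * normc (B i j)) ->
  frob_norm A < c * frob_norm B.
Proof.
case: m n A B => [|m] [|n] // A B _ _ AB.
(* The sign of [c] is forced by one entry: a negative [c] would make [c * normc (B ord0 ord0)]
   nonpositive, yet it exceeds a modulus. *)
have c0 : 0 <= c.
  have := le_lt_trans (normc_ge0 _) (AB ord0 ord0).
  by case: (lerP 0 c) => // c0; rewrite ltNge mulr_le0_ge0 ?normc_ge0 ?ltW.
rewrite -(@ltr_pXn2r _ 2) ?nnegrE ?mulr_ge0 ?frob_norm_ge0 //.
rewrite exprMn !sqr_frob_norm mulr_sumr; apply: ltr_sum.
  by apply/hasP; exists ord0; rewrite ?mem_index_enum.
move=> i _; rewrite mulr_sumr; apply: ltr_sum.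
  by apply/hasP; exists ord0; rewrite ?mem_index_enum.
by move=> j _; rewrite -exprMn ltr_pXn2r ?nnegrE ?mulr_ge0 ?normc_ge0.
Qed.

Lemma frob_norm_le_const {R : realType} {m n} (A : 'M[R[i]]_(m, n)) c :
  0 <= c -> (forall i j, normc (A i j) <= c) ->
  frob_norm A <= Num.sqrt (m%:R * n%:R) * c.
Proof.
move=> c0 Ac; rewrite frob_norm_le_sqr ?mulr_ge0 ?sqrtr_ge0 //.
rewrite sqr_frob_norm exprMn sqr_sqrtr ?mulr_ge0 //.
apply: (@le_trans _ _ (\sum_(i < m) \sum_(j < n) c ^+ 2)).
  by do 2 (apply: ler_sum => ? _); rewrite ler_pXn2r ?nnegrE ?normc_ge0.
by rewrite !sumr_const !card_ord -mulrnA -[leLHS]mulr_natl mulnC natrM.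
Qed.

Lemma frob_norm_ge_const {R : realType} {m n} (A : 'M[R[i]]_(m, n)) c :
  0 <= c -> (forall i j, c <= normc (A i j)) ->
  Num.sqrt (m%:R * n%:R) * c <= frob_norm A.
Proof.
move=> c0 Ac; rewrite -(@ler_pXn2r _ 2) ?nnegrE ?mulr_ge0 ?sqrtr_ge0 //.
rewrite sqr_frob_norm exprMn sqr_sqrtr ?mulr_ge0 //.
apply: (@le_trans _ _ (\sum_(i < m) \sum_(j < n) c ^+ 2)).
  by rewrite !sumr_const !card_ord -mulrnA -[leRHS]mulr_natl mulnC natrM.
by do 2 (apply: ler_sum => ? _); rewrite ler_pXn2r ?nnegrE ?normc_ge0.
Qed.

(** A row permutation keeps the norm, the identity block contributes exactly [r] to its square, and
    each of the [(m - r) * r] entries of [E] at most [e ^+ 2]. *)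
Lemma frob_norm_interp_mx {R : realType} {m r} (hr : (r <= m)%N) (P : 'S_m)
    (E : 'M[R[i]]_(m - r, r)) (e : R) : (forall i j, normc (E i j) <= e) ->
  frob_norm (interp_mx hr P E)
    <= Num.sqrt (r%:R + (m - r)%N%:R * r%:R * e ^+ 2).
Proof.
move=> Ee; have mre0 : 0 <= r%:R + (m - r)%N%:R * r%:R * e ^+ 2 :> R.
  by rewrite addr_ge0 // mulr_ge0 ?sqr_ge0 // mulr_ge0.
rewrite frob_norm_le_sqr ?sqrtr_ge0 // sqr_frob_norm sqr_sqrtr //.
rewrite /interp_mx -row_permE.
under eq_bigr => i _ do under eq_bigr => j _ do rewrite mxE.
(* Summing along [P^-1] undoes the permutation; the next reindexing undoes the cast, so that the row
   sum splits into the two blocks. *)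
rewrite (reindex_inj (perm_inj (s := P^-1))) /=.
under eq_bigr => i _ do under eq_bigr => j _ do rewrite permKV castmxE /=.
rewrite (reindex (cast_ord (subnKC hr))) /=; last first.
  by exists (cast_ord (esym (subnKC hr))) => i _; rewrite ?cast_ordK ?cast_ordKV.
under eq_bigr => i _ do under eq_bigr => j _ do rewrite cast_ordK cast_ord_id.
rewrite big_split_ord /=; apply: lerD.
  rewrite le_eqVlt; apply/orP; left; apply/eqP.
  transitivity (\sum_(i < r) (1 : R)); last by rewrite sumr_const card_ord.
  apply: eq_bigr => i _; rewrite (bigD1 i) //= col_mxEu mxE eqxx normc1 expr1n.
  rewrite big1 ?addr0 // => j ji.
  by rewrite col_mxEu mxE eq_sym (negPf ji) normc0 expr0n.
apply: (@le_trans _ _ (\sum_(i < m - r) \sum_(j < r) e ^+ 2)).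
  apply: ler_sum => i _; apply: ler_sum => j _; rewrite col_mxEd.
  rewrite ler_pXn2r ?nnegrE ?normc_ge0 //.
  (* [0 <= e] is read off an entry of [E]; when [E] has no entries, [e] may be negative. *)
  exact: le_trans (normc_ge0 _) (Ee i j).
by rewrite !sumr_const !card_ord -mulrnA -[leLHS]mulr_natl mulnC natrM.
Qed.

(** * Sums over finite sets and the norm of a row-deleted kernel matrix *)

Lemma sum_nth {V : nmodType} {T : Type} (x0 : T) (s : seq T) (F : T -> V) :
  \sum_(i < size s) F (nth x0 s i) = \sum_(x <- s) F x.
Proof. by rewrite (big_nth x0) big_mkord. Qed.

Lemma sumr_const_seq {V : nmodType} {T : Type} (s : seq T) (c : V) :
  \sum_(x <- s) c = c *+ size s.
Proof. by rewrite big_const_seq count_predT iter_addr_0. Qed.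

Lemma sum_fset_splitD {V : nmodType} {T : choiceType} (A B : {fset T})
    (F : T -> V) : B `<=` A ->
  \sum_(x <- A) F x = \sum_(x <- B) F x + \sum_(x <- A `\` B) F x.
Proof.
move=> BA; rewrite -big_cat /=; apply: perm_big; apply: uniq_perm => [||x].
- exact: fset_uniq.
- rewrite cat_uniq !fset_uniq andbT /=; apply/hasPn => x.
  by rewrite in_fsetD => /andP[].
rewrite mem_cat in_fsetD; case: (boolP (x \in B)) => //= xB.
exact: (fsubsetP BA).
Qed.

Lemma sqr_frob_norm_kernel_mx {R : realType} d (A B : seq R[i]) :
  frob_norm (kernel_mx d A B) ^+ 2 =
  \sum_(x <- A) \sum_(y <- B) normc (kappa d x y) ^+ 2.
Proof.
rewrite sqr_frob_norm -(sum_nth 0); apply: eq_bigr => i _.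
rewrite -(sum_nth 0); apply: eq_bigr => j _.
by rewrite mxE.
Qed.

(* The deleted rows carry at least a fixed fraction of the squared norm. *)
Lemma frob_norm_kernel_mx_sub {R : realType} d (X Xhat Y : {fset R[i]})
    (a b : R) : Xhat `<=` X -> X != fset0 -> 0 < a <= b ->
  (forall x y, x \in X -> y \in Y -> a <= normc (kappa d x y) <= b) ->
  frob_norm (kernel_mx d Xhat Y) <=
    Num.sqrt (1 - (size X - size Xhat)%N%:R * a ^+ 2 / ((size X)%:R * b ^+ 2))
    * frob_norm (kernel_mx d X Y).
Proof.
move=> sX X0 /andP[a0 ab] kab.
have b0 : 0 < b := lt_le_trans a0 ab.
have m0 : 0 < (size X)%:R :> R by rewrite ltr0n cardfs_gt0.
have mb0 : 0 < (size X)%:R * b ^+ 2 by rewrite mulr_gt0 ?exprn_gt0.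
(* [Num.sqrt] sends negative numbers to 0, so squaring it back requires this sign; it follows from
   [a <= b] and the fact that at most all rows are deleted. *)
have q0 : 0 <= 1 - (size X - size Xhat)%N%:R * a ^+ 2 / ((size X)%:R * b ^+ 2).
  rewrite subr_ge0 ler_pdivrMr // mul1r ler_pM ?sqr_ge0 //.
    by rewrite ler_nat leq_subr.
  by rewrite ler_pXn2r ?nnegrE ?(ltW a0) ?(ltW b0).
rewrite frob_norm_le_sqr ?mulr_ge0 ?sqrtr_ge0 ?frob_norm_ge0 //.
rewrite exprMn (sqr_sqrtr q0) !sqr_frob_norm_kernel_mx.
set S := \sum_(x <- X) _.
have S_le : S <= (size X)%:R * (size Y)%:R * b ^+ 2.
  apply: (@le_trans _ _ (\sum_(x <- X) \sum_(y <- Y) b ^+ 2)).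
    rewrite /S big_seq [leRHS]big_seq; apply: ler_sum => x xX.
    rewrite big_seq [leRHS]big_seq; apply: ler_sum => y yY.
    have /andP[_ kb] := kab x y xX yY.
    by rewrite ler_pXn2r ?nnegrE ?normc_ge0 ?(ltW b0).
  by rewrite !sumr_const_seq -mulrnA -[leLHS]mulr_natl mulnC natrM.
have D_ge : (size X - size Xhat)%N%:R * (size Y)%:R * a ^+ 2 <=
    \sum_(x <- X `\` Xhat) \sum_(y <- Y) normc (kappa d x y) ^+ 2.
  apply: (@le_trans _ _ (\sum_(x <- X `\` Xhat) \sum_(y <- Y) a ^+ 2)).
    rewrite !sumr_const_seq -mulrnA -[leRHS]mulr_natl mulnC natrM.
    by rewrite -(cardfsDS sX).
  rewrite big_seq [leRHS]big_seq; apply: ler_sum => x.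
  rewrite in_fsetD => /andP[_ xX].
  rewrite big_seq [leRHS]big_seq; apply: ler_sum => y yY.
  have /andP[ka _] := kab x y xX yY.
  by rewrite ler_pXn2r ?nnegrE ?normc_ge0 ?(ltW a0).
rewrite (_ : \sum_(x <- Xhat) _ =
  S - \sum_(x <- X `\` Xhat) \sum_(y <- Y) normc (kappa d x y) ^+ 2);
  last by rewrite /S (sum_fset_splitD _ _ _ sX) addrK.
(* What remains is that the fraction of [S] is at most the deleted part: the upper bound on [S]
   cancels the denominator and leaves exactly the lower bound [D_ge]. *)
rewrite mulrBl mul1r lerD2l lerN2; apply: le_trans D_ge.
rewrite mulrAC ler_pdivrMr //.
have c0 : 0 <= (size X - size Xhat)%N%:R * a ^+ 2 :> R.
  by rewrite mulr_ge0 ?sqr_ge0.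
by rewrite (le_trans (ler_wpM2l c0 S_le)) // le_eqVlt; apply/orP; left;
  apply/eqP; ring.
Qed.

(** * Kernel entries, proxy points and the proxy kernel *)

Lemma normc_kappa {R : realType} d (x y : R[i]) :
  normc (kappa d x y) = (normc (x - y) ^+ d)^-1.
Proof. by rewrite /kappa div1r normcV normcX. Qed.

Lemma normc_kappa_bounds {R : realType} d (x y : R[i]) (a b : R) :
  0 < a -> a <= normc (x - y) <= b ->
  (b ^+ d)^-1 <= normc (kappa d x y) <= (a ^+ d)^-1.
Proof.
move=> a0 /andP[ax xb]; have x0 := lt_le_trans a0 ax.
have b0 := lt_le_trans x0 xb.
rewrite normc_kappa !lef_pV2 ?posrE ?exprn_gt0 //.
by rewrite !lerXn2r ?nnegrE ?(ltW a0) ?(ltW x0) ?(ltW b0).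
Qed.

Lemma kappa_neq0 {R : realType} d (x y : R[i]) :
  x != y -> kappa d x y != 0.
Proof. by move=> xy; rewrite /kappa div1r invr_eq0 expf_neq0 // subr_eq0. Qed.

Lemma normc_expi {R : realType} (t : R) : normc (expi t) = 1.
Proof. by rewrite /normc /= cos2Dsin2 sqrtr1. Qed.

Lemma normc_proxy_point {R : realType} N (gamma : R) j :
  0 <= gamma -> normc (proxy_point N gamma j) = gamma.
Proof.
by move=> g0; rewrite normcM normc_expi mulr1 normc_real ger0_norm.
Qed.

Lemma normc_proxy_points {R : realType} N (gamma : R) z :
  0 <= gamma -> z \in proxy_points N gamma -> normc z = gamma.
Proof. by move=> g0 /mapP[j _ ->]; apply: normc_proxy_point. Qed.

Lemma size_proxy_points {R : realType} N (gamma : R) :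
  size (proxy_points N gamma) = N.
Proof. by rewrite size_map size_iota. Qed.

Definition phi_mx {R : realType} N (Z B : seq R[i]) :
    'M[R[i]]_(size Z, size B) :=
  \matrix_(i, j) phi N Z`_i B`_j.

Definition kernel_tilde_mx {R : realType} d N (gamma : R) (A B : seq R[i]) :
    'M[R[i]]_(size A, size B) :=
  \matrix_(i, j) kappa_tilde d N gamma A`_i B`_j.

(** The proxy sum over [j] is the inner sum of a matrix product, which lets a factorization of the
    proxy columns act on the proxy kernel. *)
Lemma kernel_tilde_mxE {R : realType} d N (gamma : R) (A B : seq R[i]) :
  kernel_tilde_mx d N gamma A B =
  kernel_mx d A (proxy_points N gamma) *m phi_mx N (proxy_points N gamma) B.
Proof.
apply/matrixP => i j; rewrite !mxE; under [RHS]eq_bigr do rewrite !mxE.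
rewrite (sum_nth 0 _ (fun z => kappa d A`_i z * phi N z B`_j)) big_map.
(* The range [1 <= j < N.+1] is [iota 1 N], the index list of [proxy_points]. *)
by rewrite /kappa_tilde /index_iota subSS subn0.
Qed.

(** The reverse triangle inequality keeps [y - z] at modulus above [gamma2 - gamma]. The factor
    [N%:R^-1] is kept because it later cancels the number of proxy points. *)
Lemma normc_phi_le {R : realType} N (z y : R[i]) (gamma gamma2 : R) :
  normc z = gamma -> gamma < gamma2 -> gamma2 < normc y ->
  normc (phi N z y) <= N%:R^-1 * (gamma / (gamma2 - gamma)).
Proof.
move=> zg gg2 g2y; have g0 : 0 <= gamma by rewrite -zg normc_ge0.
rewrite /phi div1r !normcM !normcV zg.
rewrite -(rmorph_nat (real_complex R)) normc_real normr_nat.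
have yz := normcB_ge y z; rewrite zg in yz.
rewrite ler_wpM2l ?invr_ge0 // ler_wpM2l // lef_pV2 ?posrE ?subr_gt0 //; lra.
Qed.

(** Turns the relative tolerance into an absolute error proportional to the kernel entry, the form
    needed for entrywise comparison of norms. *)
Lemma normc_kappa_tildeB {R : realType} d N (gamma : R) (x y : R[i]) :
  x != y ->
  normc (kappa_tilde d N gamma x y - kappa d x y) =
  normc (proxy_error d N gamma x y) * normc (kappa d x y).
Proof. by move=> xy; rewrite -normcM /proxy_error divfK // kappa_neq0. Qed.

(** * The error bounds for the row factorization and for the two-sided one *)

Theorem theorem4p1 (R : realType) (d N : nat) (hd : (0 < d)%N) (hN : (0 < N)%N)
  (X Y : {fset R[i]}) (hX0 : X != fset0) (hY0 : Y != fset0)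
  (gamma1 gamma2 gamma3 gammas : R)
  (hgamma12 : gamma1 < gamma2)
  (hX : forall x : R[i], x \in X -> 0 < normc x < gamma1)
  (hY : forall y : R[i], y \in Y -> gamma2 < normc y < gamma3)
  (hgammas : nearly_optimal_radius d N gamma1 gamma2 gamma3 gammas)
  (Xhat Yhat : {fset R[i]}) (hXhat : Xhat `<=` X) (hYhat : Yhat `<=` Y)
  (P : 'S_(size X)) (E : 'M[R[i]]_(size X - size Xhat, size Xhat))
  (Q : 'S_(size Y)) (F : 'M[R[i]]_(size Y - size Yhat, size Yhat))
  (U : 'M[R[i]]_(size X, size Xhat)) (V : 'M[R[i]]_(size Y, size Yhat))
  (hU : U = interp_mx (fsubset_leq_card hXhat) P E)
  (hV : V = interp_mx (fsubset_leq_card hYhat) Q F)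
  (tau1 tau2 e : R)
  (htau1 : forall x y : R[i], x \in X -> y \in Y ->
     normc (proxy_error d N gammas x y) < tau1)
  (htau2X : frob_norm (kernel_mx d X (proxy_points N gammas)
                       - U *m kernel_mx d Xhat (proxy_points N gammas))
            <= tau2 * frob_norm (kernel_mx d X (proxy_points N gammas)))
  (htau2Y : frob_norm (kernel_mx d Xhat Y - kernel_mx d Xhat Yhat *m V^T)
            <= tau2 * frob_norm (kernel_mx d Xhat Y))
  (hE : forall i j, normc (E i j) <= e)
  (hF : forall i j, normc (F i j) <= e) :
  let m := size X in
  let r := size Xhat in
  frob_norm (kernel_mx d X Y - U *m kernel_mx d Xhat Y)
    / frob_norm (kernel_mx d X Y)
  < s1 d m r gamma1 gamma2 gamma3 e * tau1
    + s2 d gamma1 gamma2 gamma3 gammas * tau2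
  /\
  frob_norm (kernel_mx d X Y - U *m kernel_mx d Xhat Yhat *m V^T)
    / frob_norm (kernel_mx d X Y)
  < s1 d m r gamma1 gamma2 gamma3 e * tau1
    + s2_tilde d m r gamma1 gamma2 gamma3 gammas e * tau2.
Proof.
move=> m r.
have [/andP[g1g gg2] _] := hgammas.
have [x0 x0X] := fset0Pn _ hX0.
have [y0 y0Y] := fset0Pn _ hY0.
have g1_gt0 : 0 < gamma1 by have /andP[] := hX x0 x0X; apply: lt_trans.
have g2g3 : gamma2 < gamma3 by have /andP[] := hY y0 y0Y; apply: lt_trans.
have g_gt0 : 0 < gammas by exact: lt_trans g1g.
have m_gt0 : (0 < m)%N by rewrite /m cardfs_gt0.
have n_gt0 : (0 < size Y)%N by rewrite cardfs_gt0.
have XY_bounds x y : x \in X -> y \in Y ->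
    gamma2 - gamma1 <= normc (x - y) <= gamma1 + gamma3.
  move=> /hX/andP[_ x1] /hY/andP[y2 y3].
  have := normcB_ge y x; have := normcB_le x y.
  rewrite -opprB normcN; lra.
have XY_neq x y : x \in X -> y \in Y -> x != y.
  move=> xX yY; apply: contraTneq (XY_bounds x y xX yY) => ->.
  by rewrite subrr normc0 subr_le0 leNgt hgamma12.
have kXY x y (xX : x \in X) (yY : y \in Y) :=
  normc_kappa_bounds d _ _ _ _ (etrans (subr_gt0 _ _) hgamma12)
    (XY_bounds x y xX yY).
set K := kernel_mx d X Y; set Kh := kernel_mx d Xhat Y.
set Z := proxy_points N gammas.
have tau1_gt0 : 0 < tau1 := le_lt_trans (normc_ge0 _) (htau1 x0 y0 x0X y0Y).
have d13_gt0 : 0 < (gamma1 + gamma3) ^+ d by rewrite exprn_gt0 //; lra.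
have d21_gt0 : 0 < (gamma2 - gamma1) ^+ d by rewrite exprn_gt0 //; lra.
have dg1_gt0 : 0 < (gammas - gamma1) ^+ d by rewrite exprn_gt0 //; lra.
have d13_ge0 := ltW d13_gt0.
have w_gt0 : 0 < Num.sqrt (m%:R * (size Y)%:R) :> R.
  by rewrite sqrtr_gt0 mulr_gt0 ?ltr0n.
have K_ge : Num.sqrt (m%:R * (size Y)%:R) * ((gamma1 + gamma3) ^+ d)^-1
    <= frob_norm K.
  apply: frob_norm_ge_const => [|i j]; first by rewrite invr_ge0.
  by rewrite mxE; have /andP[] := kXY _ _ (mem_nth 0 (ltn_ord i))
    (mem_nth 0 (ltn_ord j)).
have K_gt0 : 0 < frob_norm K.
  by apply: lt_le_trans K_ge; rewrite mulr_gt0 ?invr_gt0.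
have K_ge0 := ltW K_gt0.
have kXZ x z : x \in X -> z \in Z -> ((gammas + gamma1) ^+ d)^-1
    <= normc (kappa d x z) <= ((gammas - gamma1) ^+ d)^-1.
  move=> /hX/andP[_ x1] /(normc_proxy_points _ _ _ (ltW g_gt0)) zg.
  apply: normc_kappa_bounds; first by rewrite subr_gt0.
  have := normcB_ge z x; have := normcB_le x z.
  rewrite -opprB normcN; lra.
(* Positivity of this norm makes the row tolerance inequality yield [0 <= tau2]. *)
have KZ_gt0 : 0 < frob_norm (kernel_mx d X Z).
  have dg1_gt0' : 0 < (gammas + gamma1) ^+ d by rewrite exprn_gt0 ?addr_gt0.
  apply: (@lt_le_trans _ _ (Num.sqrt (m%:R * (size Z)%:R)
    * ((gammas + gamma1) ^+ d)^-1)).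
    by rewrite mulr_gt0 ?invr_gt0 // sqrtr_gt0 mulr_gt0 ?ltr0n
      ?size_proxy_points.
  apply: frob_norm_ge_const => [|i j]; first by rewrite invr_ge0 ltW.
  by rewrite mxE; have /andP[] := kXZ _ _ (mem_nth 0 (ltn_ord i))
    (mem_nth 0 (ltn_ord j)).
have KZ_le : frob_norm (kernel_mx d X Z)
    <= Num.sqrt (m%:R * N%:R) * ((gammas - gamma1) ^+ d)^-1.
  rewrite -[N in leRHS](size_proxy_points N gammas).
  apply: frob_norm_le_const => [|i j]; first by rewrite invr_ge0 ltW.
  by rewrite mxE; have /andP[] := kXZ _ _ (mem_nth 0 (ltn_ord i))
    (mem_nth 0 (ltn_ord j)).
have tau2_ge0 : 0 <= tau2.
  by rewrite -(pmulr_lge0 _ KZ_gt0) (le_trans (frob_norm_ge0 _) htau2X).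
set Phi := phi_mx N Z Y.
have Phi_le : frob_norm Phi <=
    Num.sqrt (N%:R * (size Y)%:R) * (N%:R^-1 * (gammas / (gamma2 - gammas))).
  rewrite -[in Num.sqrt (N%:R * _)](size_proxy_points N gammas).
  apply: frob_norm_le_const => [|i j].
    by rewrite mulr_ge0 ?invr_ge0 // divr_ge0 ?subr_ge0 // ltW.
  rewrite mxE; apply: normc_phi_le => //.
    exact: (normc_proxy_points _ _ _ (ltW g_gt0) (mem_nth 0 (ltn_ord i))).
  by have /andP[] := hY _ (mem_nth 0 (ltn_ord j)).
set S2 := s2 d gamma1 gamma2 gamma3 gammas.
have S2_ge0 : 0 <= S2.
  rewrite /S2 /s2 divr_ge0 //; first by rewrite mulr_ge0 // ltW.
  by rewrite mulr_ge0 ?subr_ge0 ?(ltW gg2) ?(ltW dg1_gt0).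
have N_gt0 : 0 < N%:R :> R by rewrite ltr0n.
(* Multiplying [KZ_le] by [Phi_le], the powers of [N] cancel and [Num.sqrt (m * n)] is left, with
   [n] the size of [Y]. The same root occurs in [K_ge], and the quotient of the remaining constants
   is [s2]. *)
have KZPhi : frob_norm (kernel_mx d X Z) * frob_norm Phi <= S2 * frob_norm K.
  apply: le_trans (ler_wpM2l S2_ge0 K_ge).
  apply: (le_trans (ler_pM (frob_norm_ge0 _) (frob_norm_ge0 _) KZ_le Phi_le)).
  rewrite le_eqVlt; apply/orP; left; apply/eqP.
  (* [field] sees [Num.sqrt N%:R] as an atom, so [N%:R^-1] has to be expressed through it. *)
  rewrite /S2 /s2 !sqrtrM // (_ : N%:R^-1 = Num.sqrt N%:R ^- 2); last first.
    by rewrite sqr_sqrtr // ltW.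
  by field; rewrite !lt0r_neq0 ?sqrtr_gt0 ?subr_gt0.
set q := Num.sqrt (1 - (m - r)%N%:R * (gamma2 - gamma1) ^+ (2 * d)%N
                      / (m%:R * (gamma1 + gamma3) ^+ (2 * d)%N)).
set u := Num.sqrt (r%:R + (m - r)%N%:R * r%:R * e ^+ 2).
have U_le : frob_norm U <= u by rewrite hU; apply: frob_norm_interp_mx.
have u_ge0 : 0 <= u by apply: sqrtr_ge0.
have q_ge0 : 0 <= q by apply: sqrtr_ge0.
have Kh_le : frob_norm Kh <= q * frob_norm K.
  (* The entries of [K] lie between [a], the inverse of [(gamma1 + gamma3) ^+ d], and [b], the
     inverse of [(gamma2 - gamma1) ^+ d]; [a ^+ 2 / b ^+ 2] is the quotient inside [s1]. *)
  have -> : q = Num.sqrt (1 - (m - r)%N%:R * ((gamma1 + gamma3) ^+ d)^-1 ^+ 2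
      / (m%:R * ((gamma2 - gamma1) ^+ d)^-1 ^+ 2)).
    rewrite /q; congr (Num.sqrt (1 - _)); rewrite mulnC !exprM.
    have mR0 : m%:R != 0 :> R by rewrite pnatr_eq0 -lt0n.
    by field; rewrite mR0 !lt0r_neq0.
  apply: frob_norm_kernel_mx_sub => //.
  by have /andP[ab ba] := kXY _ _ x0X y0Y; rewrite invr_gt0 d13_gt0 (le_trans ab).
have err_X : frob_norm (K - kernel_mx d X Z *m Phi) < tau1 * frob_norm K.
  apply: frob_norm_lt_entry => // i j.
  rewrite -kernel_tilde_mxE !mxE -normcN opprB.
  set x := X`_i; set y := Y`_j.
  have xX : x \in X by apply: mem_nth.
  have yY : y \in Y by apply: mem_nth.
  rewrite normc_kappa_tildeB ?XY_neq // ltr_pM2r ?htau1 //.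
  have /andP[k0 _] := kXY _ _ xX yY.
  by apply: lt_le_trans k0; rewrite invr_gt0.
(* Only a weak inequality, since [Xhat] may be empty; [err_X] carries the strictness. *)
have err_Xhat :
    frob_norm (kernel_mx d Xhat Z *m Phi - Kh) <= tau1 * frob_norm Kh.
  apply: frob_norm_le_entry => [|i j]; first exact: ltW.
  rewrite -kernel_tilde_mxE !mxE.
  set x := Xhat`_i; set y := Y`_j.
  have xX : x \in X by apply: (fsubsetP hXhat); apply: mem_nth.
  have yY : y \in Y by apply: mem_nth.
  by rewrite normc_kappa_tildeB ?XY_neq // ler_wpM2r ?normc_ge0 // ltW // htau1.
have S1E : s1 d m r gamma1 gamma2 gamma3 e = 1 + u * q by [].
have row_err : frob_norm (K - U *m Kh)
    < (s1 d m r gamma1 gamma2 gamma3 e * tau1 + S2 * tau2) * frob_norm K.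
  have -> : K - U *m Kh = (K - kernel_mx d X Z *m Phi)
      + ((kernel_mx d X Z - U *m kernel_mx d Xhat Z) *m Phi
         + U *m (kernel_mx d Xhat Z *m Phi - Kh)).
    by rewrite mulmxBl mulmxBr !mulmxA !subrKA.
  apply: le_lt_trans (frob_normD _ _) _.
  have mid : frob_norm ((kernel_mx d X Z - U *m kernel_mx d Xhat Z) *m Phi)
      <= tau2 * (S2 * frob_norm K).
    apply: le_trans (frob_normM _ _) _.
    apply: le_trans (ler_wpM2r (frob_norm_ge0 _) htau2X) _.
    by rewrite -mulrA ler_wpM2l.
  have last : frob_norm (U *m (kernel_mx d Xhat Z *m Phi - Kh))
      <= u * (tau1 * (q * frob_norm K)).
    apply: le_trans (frob_normM _ _) _.
    apply: ler_pM; rewrite ?frob_norm_ge0 //.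
    by apply: le_trans err_Xhat _; rewrite ler_wpM2l // ltW.
  have := frob_normD ((kernel_mx d X Z - U *m kernel_mx d Xhat Z) *m Phi)
    (U *m (kernel_mx d Xhat Z *m Phi - Kh)).
  rewrite S1E; lra.
(* Clearing the positive denominator turns the first claim into [row_err]; the two-sided claim
   remains. *)
split; rewrite ltr_pdivrMr //.
have -> : K - U *m kernel_mx d Xhat Yhat *m V^T
    = (K - U *m Kh) + U *m (Kh - kernel_mx d Xhat Yhat *m V^T).
  by rewrite mulmxBr mulmxA addrA subrK.
apply: le_lt_trans (frob_normD _ _) _.
(* The column error is amplified by [U] and measured against [Kh], which costs [u * q], that is
   [s1 - 1]: the amount by which [s2_tilde] exceeds [s2]. *)
have col_err : frob_norm (U *m (Kh - kernel_mx d Xhat Yhat *m V^T))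
    <= u * (tau2 * (q * frob_norm K)).
  apply: le_trans (frob_normM _ _) _.
  apply: ler_pM; rewrite ?frob_norm_ge0 //.
  by apply: le_trans htau2Y _; rewrite ler_wpM2l.
rewrite /s2_tilde -/S2; move: row_err; rewrite S1E; lra.
Qed.
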